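(* Let $T=\{2143,2314,2431\}$. Then $$F_T(x)=\frac{1-6x+10x^2-3x^3+x^4}{(1-3x+x^2)(1-4x+2x^2)}.$$
   Context: $S_n(T)$ denotes the set of permutations $\pi$ of $[n]=\{1,\dots,n\}$ (one-line notation) that avoid every pattern $\tau\in T$, i.e. no subsequence of $\pi$ is order-isomorphic to $\tau$. $F_T(x)=\sum_{n\ge 0}|S_n(T)|x^n$, a formal power series, with $|S_0(T)|=1$. *)

(* Defs.v *)
From HB Require Import structures.
From mathcomp Require Import all_boot all_order all_algebra all_fingroup.

Set Implicit Arguments.
Unset Strict Implicit.
Unset Printing Implicit Defensive.

Import GRing.Theory.

(* One-line notation: the word s(1) s(2) ... s(n) on the letters 1, ..., n.
   'S_n permutes {0, ..., n-1}, hence the shift by one. *)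
Definition one_line (n : nat) (s : 'S_n) : seq nat :=
  [seq (val (s i)).+1 | i <- enum 'I_n].

Definition order_isomorphic (u t : seq nat) : bool :=
  (size u == size t) &&
  [forall i : 'I_(size t), forall j : 'I_(size t),
     (nth 0 u i < nth 0 u j) == (nth 0 t i < nth 0 t j)].

(* The masks of length size w enumerate the subsequences of w; see
   contains_patternP. *)
Definition contains_pattern (w t : seq nat) : bool :=
  [exists m : (size w).-tuple bool, order_isomorphic (mask m w) t].

Lemma contains_patternP (w t : seq nat) :
  reflect (exists2 u, subseq u w & order_isomorphic u t) (contains_pattern w t).
Proof.
apply: (iffP existsP) => [[m iso_m]|[u /subseqP[m sz_m ->] iso_u]].
  by exists (mask m w) => //; exact: mask_subseq.
by exists (Tuple (introT eqP sz_m)).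
Qed.

Definition avoiders (n : nat) (T : seq (seq nat)) : {set 'S_n} :=
  [set s : 'S_n | all (fun t => ~~ contains_pattern (one_line s) t) T].

Local Open Scope ring_scope.

(* A formal power series is its sequence of coefficients; equality of series
   is the pointwise equality =1. *)
Definition fps (R : Type) : Type := nat -> R.

Definition fps_of_poly (R : nzRingType) (p : {poly R}) : fps R := fun n => p`_n.

Definition fps_mul (R : nzRingType) (f g : fps R) : fps R :=
  fun n => \sum_(i < n.+1) f i * g (n - i)%N.

(* [:: g 0; ...; g n] for the inverse g of f, obtained by solving f * g = 1
   degree by degree; meaningful when f 0 is a unit. *)
Fixpoint fps_inv_coefs (R : comUnitRingType) (f : fps R) (n : nat) : seq R :=
  if n is m.+1 then
    let s := fps_inv_coefs f m in
    rcons s (- (f 0%N)^-1 * \sum_(i < m.+1) f i.+1 * s`_(m - i))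
  else [:: (f 0%N)^-1].

Definition fps_inv (R : comUnitRingType) (f : fps R) : fps R :=
  fun n => (fps_inv_coefs f n)`_n.

Definition fps_div (R : comUnitRingType) (f g : fps R) : fps R :=
  fps_mul f (fps_inv g).

Lemma size_fps_inv_coefs (R : comUnitRingType) (f : fps R) (n : nat) :
  size (fps_inv_coefs f n) = n.+1.
Proof. by elim: n => //= n IHn; rewrite size_rcons IHn. Qed.

Lemma nth_fps_inv_coefs (R : comUnitRingType) (f : fps R) (n i : nat) :
  (i <= n)%N -> (fps_inv_coefs f n)`_i = fps_inv f i.
Proof.
elim: n => [|n IHn]; first by rewrite leqn0 => /eqP->.
rewrite leq_eqVlt => /predU1P[-> //|lt_i_n1].
by rewrite /= nth_rcons size_fps_inv_coefs lt_i_n1 IHn.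
Qed.

Lemma fps_inv_rec (R : comUnitRingType) (f : fps R) (n : nat) :
  fps_inv f n.+1 = - (f 0%N)^-1 * \sum_(i < n.+1) f i.+1 * fps_inv f (n - i)%N.
Proof.
rewrite {1}/fps_inv /= nth_rcons size_fps_inv_coefs ltnn eqxx.
by congr (_ * _); apply: eq_bigr => i _; rewrite nth_fps_inv_coefs ?leq_subr.
Qed.

Lemma fps_mulV (R : comUnitRingType) (f : fps R) :
  f 0%N \is a GRing.unit -> fps_mul f (fps_inv f) =1 fps_of_poly 1.
Proof.
move=> f0_unit [|n]; rewrite /fps_mul /fps_of_poly coef1.
  by rewrite big_ord1 /= divrr.
rewrite big_ord_recl subn0 fps_inv_rec mulrA mulrN divrr // mulN1r.
by rewrite (eq_bigr (fun i : 'I_n.+1 => f i.+1 * fps_inv f (n - i)%N)) ?addNr.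
Qed.

(* F_T(x) = \sum_n |S_n(T)| x^n, with rational coefficients. *)
Definition avoidance_gf (T : seq (seq nat)) : fps rat :=
  fun n => #|avoiders n T|%:R.

(* Main.v *)
Require Import Defs.
From HB Require Import structures.
From mathcomp Require Import all_boot all_order all_algebra all_fingroup.
From mathcomp Require Import zify ring.

(* All three patterns begin with their second smallest letter, so avoidance is
   a condition on each letter of the word and the smaller and larger letters
   following it. Let the word be a w with a = m + 1, and let b be the number of
   letters larger than a. If m = 0 or b = 0 then w is an arbitrary avoider.
   Otherwise the b large letters either form one increasing block of w, and
   shrinking that block to a single letter gives an arbitrary avoider of length
   m + 1; or they form an increasing prefix and an increasing suffix of w, the
   prefix lying above the suffix, and the word S of small letters between them
   is any word such that S (m + 1) is an avoider. With f n the number of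
   avoiders of length n, and g n the number of those of length n + 1 that end
   with their maximum,
     f (n + 2) = 2 f (n + 1) + \sum_(1 <= m <= n) (f (m + 1) + (n - m) g m),
     g (n + 1) = g n + \sum_(1 <= m <= n) g m.
   Differencing gives the recurrence whose characteristic polynomial is the
   given denominator. *)

Set Implicit Arguments.
Unset Strict Implicit.
Unset Printing Implicit Defensive.

Import GRing.Theory.

(** * Avoidance as a condition on four letters *)

Definition avoids (w : seq nat) : bool :=
  all (fun t => ~~ contains_pattern w t)
    [:: [:: 2; 1; 4; 3]; [:: 2; 3; 1; 4]; [:: 2; 4; 3; 1]].

Arguments avoids : simpl never.

(** The disjuncts describe occurrences of 2143, 2314 and 2431, in this order; a chain of three
    strict inequalities fixes the relative order of four letters. *)
Definition forbidden (x y z t : nat) : bool :=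
  [|| [&& y < x, x < t & t < z], [&& z < x, x < y & y < t]
    | [&& t < x, x < z & z < y]].

Lemma order_isomorphic4 (p q r s x y z t : nat) :
  order_isomorphic [:: x; y; z; t] [:: p; q; r; s] =
  [&& (x < y) == (p < q), (x < z) == (p < r), (x < t) == (p < s),
      (y < z) == (q < r), (y < t) == (q < s), (z < t) == (r < s),
      (y < x) == (q < p), (z < x) == (r < p), (t < x) == (s < p),
      (z < y) == (r < q), (t < y) == (s < q) & (t < z) == (s < r)].
Proof.
rewrite /order_isomorphic /=; apply/idP/idP => [H|H].
  have K (i j : 'I_4) : (nth 0 [:: x; y; z; t] i < nth 0 [:: x; y; z; t] j) ==
      (nth 0 [:: p; q; r; s] i < nth 0 [:: p; q; r; s] j).
    by move/forallP: H => /(_ i)/forallP.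
  pose o k := @inord 3 k.
  move: (K (o 0) (o 1)) (K (o 0) (o 2)) (K (o 0) (o 3)) (K (o 1) (o 2))
    (K (o 1) (o 3)) (K (o 2) (o 3)) (K (o 1) (o 0)) (K (o 2) (o 0)) (K (o 3) (o 0))
    (K (o 2) (o 1)) (K (o 3) (o 1)) (K (o 3) (o 2)).
  by rewrite !inordK //= => -> -> -> -> -> -> -> -> -> -> -> ->.
do 11! [case/andP: H => ? H].
by apply/forallP => -[[|[|[|[|//]]]] ?]; apply/forallP => -[[|[|[|[|//]]]] ?] //=;
  rewrite !ltnn.
Qed.

Lemma contains_pattern4P (p q r s : nat) (w : seq nat) :
  reflect (exists x y z t, subseq [:: x; y; z; t] w /\
             order_isomorphic [:: x; y; z; t] [:: p; q; r; s])
          (contains_pattern w [:: p; q; r; s]).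
Proof.
apply: (iffP (contains_patternP _ _)) => [[u sub_u iso_u]|].
  case: u sub_u iso_u (iso_u) => [|x [|y [|z [|t [|? ?]]]]] sub_u iso_u;
    case/andP => // _ _.
  by exists x, y, z, t.
by move=> [x [y [z [t [sub_u iso_u]]]]]; exists [:: x; y; z; t].
Qed.

Lemma avoidsP (w : seq nat) :
  reflect (forall x y z t, subseq [:: x; y; z; t] w -> ~~ forbidden x y z t)
          (avoids w).
Proof.
apply: (iffP idP) => [|H].
  rewrite /avoids /= andbT => /and3P[/contains_pattern4P H1 /contains_pattern4P H2
    /contains_pattern4P H3] x y z t sub; apply/negP => /or3P[] B.
  - by apply: H1; exists x, y, z, t; split=> //; rewrite order_isomorphic4 /= !(eqbF_neg, eqb_id); lia.
  - by apply: H2; exists x, y, z, t; split=> //; rewrite order_isomorphic4 /= !(eqbF_neg, eqb_id); lia.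
  - by apply: H3; exists x, y, z, t; split=> //; rewrite order_isomorphic4 /= !(eqbF_neg, eqb_id); lia.
rewrite /avoids /= andbT; apply/and3P; split; apply/contains_pattern4P;
  move=> [x [y [z [t [sub]]]]]; rewrite order_isomorphic4 /=;
  by have := H _ _ _ _ sub; rewrite /forbidden; lia.
Qed.

(** This says that the head of [x :: w] starts no occurrence; by [avoids_cons], avoidance can then
    be checked letter by letter. *)
Definition free_from (x : nat) (w : seq nat) : Prop :=
  forall y z t, subseq [:: y; z; t] w -> ~~ forbidden x y z t.

Lemma avoids_cons (x : nat) (w : seq nat) :
  avoids (x :: w) <-> free_from x w /\ avoids w.
Proof.
split=> [/avoidsP av|[okx /avoidsP av]].
  split=> [y z t sub|]; first by apply: av; rewrite /= eqxx.
  apply/avoidsP => x' y z t sub; apply: av; exact: subseq_trans (subseq_cons _ _).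
apply/avoidsP => x' y z t /=; case: eqP => [->|_]; [exact: okx|exact: av].
Qed.

Lemma avoids_subseq (v w : seq nat) : subseq v w -> avoids w -> avoids v.
Proof.
move=> sub /avoidsP av; apply/avoidsP => x y z t sub'; apply: av.
exact: subseq_trans sub.
Qed.

Lemma avoids_map (h : nat -> nat) (w : seq nat) :
  {mono h : x y / x < y} -> avoids (map h w) = avoids w.
Proof.
move=> hE.
have forbiddenE x y z t : forbidden (h x) (h y) (h z) (h t) = forbidden x y z t.
  by rewrite /forbidden !hE.
apply/avoidsP/avoidsP => av x y z t sub.
  by rewrite -forbiddenE; apply: av; exact: (map_subseq h sub).
have /subseqP[m _ E] := sub.
rewrite -map_mask in E.
case: (mask m w) E (mask_subseq m w) => [|x' [|y' [|z' [|t' [|? ?]]]]] //=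
  [-> -> -> ->] /av.
by rewrite forbiddenE.
Qed.

(** * Words that may follow a given first letter *)

Lemma subseq_cat_split (T : eqType) (q u v : seq T) :
  subseq q (u ++ v) ->
  exists q1 q2, [/\ q = q1 ++ q2, subseq q1 u & subseq q2 v].
Proof.
case/subseqP=> m sz_m ->; exists (mask (take (size u) m) u), (mask (drop (size u) m) v).
split; rewrite ?mask_subseq //.
rewrite -{1}(cat_take_drop (size u) m) mask_cat // size_takel // sz_m size_cat.
exact: leq_addr.
Qed.

Lemma subseq_cat3_split (T : eqType) (q u v w : seq T) :
  subseq q (u ++ v ++ w) ->
  exists q1 q2 q3, [/\ q = q1 ++ q2 ++ q3, subseq q1 u, subseq q2 v & subseq q3 w].
Proof.
case/subseq_cat_split=> q1 [q' [-> sub1 /subseq_cat_split[q2 [q3 [-> sub2 sub3]]]]].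
by exists q1, q2, q3.
Qed.

Lemma subseq_all (T : eqType) (p : pred T) (u v : seq T) :
  subseq u v -> all p v -> all p u.
Proof. by move=> sub /allP pv; apply/allP => x /(mem_subseq sub)/pv. Qed.

Lemma subseq_sorted_ltn (u v : seq nat) :
  subseq u v -> sorted ltn v -> sorted ltn u.
Proof. exact/subseq_sorted/ltn_trans. Qed.

(** An occurrence headed by [a] uses one smaller and two larger letters: the larger ones descend if
    they are on the same side of the smaller one, and ascend if it separates them. A single
    increasing block of larger letters allows neither. *)
Lemma free_from_block (a : nat) (S1 B S2 : seq nat) :
  all (fun y => y < a) S1 -> all (fun y => a < y) B -> all (fun y => y < a) S2 ->
  sorted ltn B -> free_from a (S1 ++ B ++ S2).
Proof.
move=> ltS1 gtB ltS2 sB y z t /subseq_cat3_split[q1 [q2 [q3 [E sub1 sub2 sub3]]]].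
move: (subseq_all sub1 ltS1) (subseq_all sub2 gtB) (subseq_all sub3 ltS2)
   (subseq_sorted_ltn sub2 sB) E.
case: q1 {sub1} => [|? [|? [|? [|]]]] /=; case: q2 {sub2} => [|? [|? [|? [|]]]] /=;
case: q3 {sub3} => [|? [|? [|? [|]]]] //= *; rewrite /forbidden;
by repeat match goal with H : _ :: _ = _ |- _ => case: H => * end; subst; lia.
Qed.

(** Two large letters on the same side of a small one lie in the same block and ascend; two
    separated by a small one descend, because [B1] lies above [B2]. *)
Lemma free_from_two_blocks (a : nat) (B1 S B2 : seq nat) :
  all (fun y => a < y) B1 -> all (fun y => y < a) S -> all (fun y => a < y) B2 ->
  sorted ltn (B2 ++ B1) -> free_from a (B1 ++ S ++ B2).
Proof.
move=> gtB1 ltS gtB2 sB y z t /subseq_cat3_split[q1 [q2 [q3 [E sub1 sub2 sub3]]]].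
move: (subseq_all sub1 gtB1) (subseq_all sub2 ltS) (subseq_all sub3 gtB2)
   (subseq_sorted_ltn (cat_subseq sub3 sub1) sB) E.
case: q1 {sub1} => [|? [|? [|? [|]]]] /=; case: q2 {sub2} => [|? [|? [|? [|]]]] /=;
case: q3 {sub3} => [|? [|? [|? [|]]]] //= *; rewrite /forbidden;
by repeat match goal with H : _ :: _ = _ |- _ => case: H => * end; subst; lia.
Qed.

(** If an occurrence starts in [B], both letters above its first one are in [B] too, as [w] lies
    below [B]. In each pattern the part up to the last of these two contains a descent, but [B]
    increases. *)
Lemma avoids_top (B w : seq nat) :
  sorted ltn B -> (forall x y, x \in B -> y \in w -> y < x) ->
  avoids (B ++ w) = avoids w.
Proof.
move=> sB ltwB; apply/idP/idP; first exact/avoids_subseq/suffix_subseq.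
move=> /avoidsP av; apply/avoidsP => x y z t /subseq_cat_split[q1 [q2 [E sub1 sub2]]].
have q12 : all (fun i => all (fun j => j < i) q2) q1.
  apply/allP => i /(mem_subseq sub1) Bi; apply/allP => j /(mem_subseq sub2).
  exact: ltwB.
have sq1 := subseq_sorted_ltn sub1 sB.
case: q1 {sub1} E q12 sq1 => [E _ _|x1 q1]; first by apply: av; rewrite E.
case: q1 => [|? [|? [|? [|]]]] /=; case: q2 {sub2} => [|? [|? [|? [|]]]] //=
  E *; case: E => * ; rewrite /forbidden; subst; lia.
Qed.

(** Two letters of [B] in an occurrence would make its two largest letters adjacent and increasing,
    while 3 and 4 are inverted in 2143 and 2431 and separated in 2314. So an occurrence meets [B] at
    most once, and [a] can stand for that letter. *)
Lemma avoids_inflate (a : nat) (S1 B S2 : seq nat) :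
  all (fun y => y < a) S1 -> all (fun y => a < y) B -> all (fun y => y < a) S2 ->
  sorted ltn B -> B != [::] -> avoids (S1 ++ B ++ S2) = avoids (S1 ++ a :: S2).
Proof.
move=> ltS1 gtB ltS2 sB nB.
have [b Bb] : exists b, b \in B by case: B nB {gtB sB} => // b B; exists b; rewrite inE eqxx.
have ltab := allP gtB _ Bb.
apply/idP/idP => [av|/avoidsP av].
  (* [h] carries [a] to the chosen letter [b] of the block and fixes everything below [a], so it
     maps the right-hand word onto a subsequence of the left-hand one. *)
  pose h y := if y < a then y else y + (b - a).
  have hE : {mono h : x y / x < y} by move=> x y; rewrite /h; do 2 case: ifP; lia.
  have hid S : all (fun y => y < a) S -> map h S = S.
    by move/allP => H; apply: map_id_in => y /H; rewrite /h => ->.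
  rewrite -(avoids_map _ hE) map_cat /= !hid //.
  have -> : h a = b by rewrite /h ltnn; lia.
  apply: avoids_subseq av; apply: cat_subseq => //.
  by rewrite -cat1s; apply: cat_subseq; rewrite ?sub1seq.
apply/avoidsP => x y z t /subseq_cat3_split[q1 [q2 [q3 [E sub1 sub2 sub3]]]].
have : forall y, subseq (q1 ++ y) (S1 ++ y) by move=> ?; rewrite cat_subseq.
move: (subseq_all sub1 ltS1) (subseq_all sub2 gtB) (subseq_all sub3 ltS2)
   (subseq_sorted_ltn sub2 sB) (cat_subseq sub1 (subseq_trans sub3 (subseq_cons _ a)))
   (cat_subseq sub1 (cat_subseq (subseq_refl [:: a]) sub3)) E.
case: q1 {sub1} => [|? [|? [|? [|? [|]]]]] /=; case: q2 {sub2} => [|? [|? [|? [|? [|]]]]] /=;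
case: q3 {sub3} => [|? [|? [|? [|? [|]]]]] //= ? ? ? ? s1 s2 [] * ; subst;
 (* [s1] omits the block letters and settles an empty [q2]; [s2] puts [a] for the block letter and
    settles a single one. *)
 try (by apply: av; exact: s1);
 try (have := av _ _ _ _ s2); rewrite /forbidden; lia.
Qed.

Lemma maximal_prefix (T : eqType) (p : pred T) (w : seq T) :
  exists u v, [/\ w = u ++ v, all p u & forall x v', v = x :: v' -> ~~ p x].
Proof.
elim: w => [|x w [u [v [-> pu vE]]]]; first by exists [::], [::].
case: (boolP (p x)) => px; first by exists (x :: u), v; rewrite /= px.
by exists [::], (x :: u ++ v); split=> // y v' [<-].
Qed.

Lemma sorted_ltn_pairs (s : seq nat) :
  uniq s -> (forall x y, subseq [:: x; y] s -> x <= y) -> sorted ltn s.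
Proof.
elim: s => // x [|y s] IH //= /andP[xys us] le2.
have := le2 x y; rewrite /= !eqxx sub0seq => /(_ isT) lexy.
apply/andP; split.
  by move: xys; rewrite inE negb_or => /andP[? _]; lia.
apply: IH => // x' y' sub; apply: le2.
exact: (subseq_trans sub (subseq_cons _ x)).
Qed.

(** Converse of [free_from_block] and [free_from_two_blocks]. A small letter makes two large ones
    ascend if they are on the same side of it and descend if it separates them; any other
    arrangement would force both orders on some pair. *)
Lemma free_from_shape (a : nat) (w : seq nat) :
  uniq w -> a \notin w -> has (fun y => y < a) w -> free_from a w ->
  (exists S1 B S2, [/\ w = S1 ++ B ++ S2, all (fun y => y < a) S1,
     all (fun y => a < y) B, all (fun y => y < a) S2 & sorted ltn B]) \/
  (exists B1 S B2, [/\ w = B1 ++ S ++ B2, all (fun y => a < y) B1,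
     all (fun y => y < a) S, all (fun y => a < y) B2 &
     [/\ B1 != [::], B2 != [::] & sorted ltn (B2 ++ B1)]]).
Proof.
move=> uw aw hasw okw.
have neq x : x \in w -> x != a by move=> xw; apply: contraNneq aw => <-.
(* [sxy], [xys] and [xsy] come from 2143, 2431 and 2314, with [a] as the letter 2 and [s] as the
   letter 1. *)
have sxy s x y : s < a -> a < x -> a < y -> subseq [:: s; x; y] w -> x < y.
  move=> lts gtx gty sub; have := subseq_uniq sub uw; have := okw _ _ _ sub.
  by rewrite /forbidden /= !inE; lia.
have xys s x y : s < a -> a < x -> a < y -> subseq [:: x; y; s] w -> x < y.
  move=> lts gtx gty sub; have := subseq_uniq sub uw; have := okw _ _ _ sub.
  by rewrite /forbidden /= !inE; lia.
have xsy s x y : s < a -> a < x -> a < y -> subseq [:: x; s; y] w -> y < x.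
  move=> lts gtx gty sub; have := subseq_uniq sub uw; have := okw _ _ _ sub.
  by rewrite /forbidden /= !inE; lia.
have sortw C : subseq C w -> (forall x y, subseq [:: x; y] C -> x < y) -> sorted ltn C.
  move=> sub H; apply: sorted_ltn_pairs => [|x y /H]; last exact: ltnW.
  exact: subseq_uniq uw.
have mem2 (C : seq nat) x y : all (fun y => a < y) C -> subseq [:: x; y] C -> a < x /\ a < y.
  by move=> gtC sub; have := subseq_all sub gtC; rewrite /= andbT => /andP.
have [S1 [V [wE ltS1 hV]]] := maximal_prefix (fun y => y < a) w.
have [B [R [VE gtB hR]]] := maximal_prefix (fun y => a < y) V.
rewrite {V}VE in wE hV.
have subB : subseq B w.
  by rewrite wE; exact: subseq_trans (prefix_subseq _ _) (suffix_subseq _ _).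
(* If no large letter remains after the block [B], the first shape holds: the small letter given by
   [hasw] lies on one side of [B] and makes it increasing. *)
have [bigR|] := boolP (has (fun y => a < y) R); last first.
  rewrite -all_predC => ltR; left; exists S1, B, R; split=> //.
    apply/allP => x xR; have := allP ltR _ xR; have := neq x.
    by rewrite wE !mem_cat xR !orbT /=; lia.
  apply: sortw => // x y sub; have [gtx gty] := mem2 _ _ _ gtB sub.
  have [s sw lts] := hasP hasw.
  move: sw; rewrite wE !mem_cat => /or3P[sS|sB|sR].
  - apply: (sxy s) => //; rewrite wE -[[:: s; _; _]]/([:: s] ++ [:: x; y] ++ [::]).
    by rewrite !cat_subseq ?sub0seq ?sub1seq.
  - by have := allP gtB _ sB; lia.
  - apply: (xys s) => //; rewrite wE -[[:: x; _; _]]/([::] ++ [:: x; y] ++ [:: s]).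
    by rewrite !cat_subseq ?sub0seq ?sub1seq.
right; case: R hR bigR wE hV => // s R hR bigR wE hV.
have lts : s < a.
  by have := hR _ _ erefl; have := neq s; rewrite wE !mem_cat inE eqxx !orbT; lia.
have {bigR}: has (fun y => a < y) R by move: bigR => /= /orP[|//]; lia.
case/hasP=> y yR gty.
case: B gtB wE hV subB => [|x B] gtB wE hV subB.
  by have := hV _ _ erefl; rewrite lts.
have gtx : a < x by case/andP: gtB.
(* A small [s1] in front would give [x < y], while [s] between [x] and [y] gives [y < x]; hence the
   word starts with the large block. *)
case: S1 ltS1 wE {hV} => [_ wE|s1 S1 /andP[lts1 _] wE]; last first.
  have : x < y.
    apply: (sxy s1) => //; rewrite wE -[[:: _; _; _]]/([:: s1] ++ [:: x] ++ [:: y]).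
    by rewrite !cat_subseq ?sub1seq ?inE ?eqxx // yR orbT.
  have : y < x.
    apply: (xsy s) => //; rewrite wE -[[:: _; _; _]]/([::] ++ [:: x] ++ [:: s; y]).
    by rewrite !cat_subseq ?sub1seq ?sub0seq //= ?eqxx ?sub1seq // inE eqxx.
  by lia.
rewrite cat0s in wE.
have [S [U [RE ltS hU]]] := maximal_prefix (fun y => y < a) R.
have [C [R2 [UE gtC hR2]]] := maximal_prefix (fun y => a < y) U.
rewrite {U}UE in RE hU; rewrite {R}RE in yR wE {hR}.
have yC : y \in C ++ R2.
  move: yR; rewrite mem_cat => /orP[/(allP ltS)|//]; lia.
case: C gtC hU hR2 yC wE yR => [|z C] gtC hU hR2 yC wE yR.
  case: R2 hR2 yC hU wE {yR} => // x2 R2 hR2 yC hU wE.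
  have := hR2 _ _ erefl; have := hU _ _ erefl; have := neq x2.
  by rewrite wE /= !(inE, mem_cat) eqxx !orbT; lia.
have gtz : a < z by case/andP: gtC.
(* Likewise a small [s2] after the second block would give [x < z] against [s] between [x] and [z];
   hence the word ends with that block. *)
case: R2 hR2 wE {yR yC hU} => [_|s2 R2 hR2 wE]; last first.
  have lts2 : s2 < a.
    have := hR2 _ _ erefl; have := neq s2.
    by rewrite wE /= !(inE, mem_cat) eqxx !orbT; lia.
  have : x < z.
    apply: (xys s2) => //; rewrite wE -(cat_cons s).
    rewrite -[[:: _; _; _]]/([:: x] ++ [::] ++ [:: z] ++ [:: s2]).
    by rewrite !cat_subseq ?sub0seq ?sub1seq ?inE ?eqxx.
  have : z < x.
    apply: (xsy s) => //; rewrite wE /= eqxx.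
    apply: (subseq_trans _ (suffix_subseq _ _)) => /=; rewrite eqxx.
    by rewrite sub1seq mem_cat inE eqxx orbT.
  by lia.
rewrite cats0 => wE; exists (x :: B), (s :: S), (z :: C); split=> //.
  by rewrite /= lts.
have sortB : sorted ltn (x :: B).
  apply: sortw => // u v sub; have [gtu gtv] := mem2 _ _ _ gtB sub.
  apply: (xys s) => //; rewrite wE -[[:: _; _; _]]/([:: u; v] ++ [:: s]) cat_subseq //.
  by rewrite sub1seq inE eqxx.
have sortC : sorted ltn (z :: C).
  apply: sortw => [|u v sub].
    by rewrite wE -cat_cons catA suffix_subseq.
  have [gtu gtv] := mem2 _ _ _ gtC sub.
  apply: (sxy s) => //; rewrite wE -[[:: _; _; _]]/([::] ++ [:: s] ++ [:: u; v]).
  by rewrite -cat_cons !cat_subseq ?sub0seq // sub1seq inE eqxx.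
split=> //; move: sortB sortC; rewrite !(sorted_pairwise ltn_trans) pairwise_cat => -> ->.
rewrite !andbT; apply/allrelP => u v uC vB.
apply: (xsy s) => //; [exact: (allP gtB)|exact: (allP gtC)|].
rewrite wE -[[:: _; _; _]]/([:: v] ++ [:: s] ++ [:: u]) -cat_cons.
by rewrite !cat_subseq ?sub1seq // inE eqxx.
Qed.

(** * Counting by first letter *)

Definition num_avoiding (n : nat) : nat := count avoids (permutations (iota 1 n)).

Definition num_avoiding_max_last (n : nat) : nat :=
  count (fun w => avoids (rcons w n.+1)) (permutations (iota 1 n)).

Lemma count_permutations_first (p : pred (seq nat)) (n : nat) :
  count p (permutations (iota 1 n.+1)) =
  \sum_(0 <= m < n.+1) count (fun w => p (m.+1 :: w))
                             (permutations (iota 1 m ++ iota m.+2 (n - m))).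
Proof.
rewrite (seq.permP (permutationsE _)) ?size_iota // undup_id ?iota_uniq //.
rewrite count_flatten -map_comp sumnE big_map.
rewrite (iotaDl 1 0) big_map -[iota 0 _]/(index_iota 0 n.+1) big_mkord.
rewrite -(iotaDl 1 0) addn0 [RHS]big_mkord; apply: eq_bigr => m _; rewrite [LHS]count_map; apply/seq.permP/perm_permutations.
rewrite [1 + m]add1n -(perm_cons m.+1).
have mI : m.+1 \in iota 1 n.+1 by rewrite mem_iota; case: m => /=; lia.
rewrite perm_sym; apply: perm_trans _ (perm_to_rem mI).
have E : n.+1 = m + (n - m).+1 by case: m {mI} => /=; lia.
by rewrite (congr1 (iota 1) E) iotaD -cat1s perm_catCA.
Qed.

Lemma perm_iota2 (n : nat) :
  perm_eq (permutations (iota 2 n)) (map (map S) (permutations (iota 1 n))).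
Proof.
have mapS_inj : injective (map S) by apply: inj_map => x y [].
apply: uniq_perm; rewrite ?map_inj_uniq ?permutations_uniq // => w.
rewrite mem_permutations; apply/idP/mapP => [pw|[v]].
  have wE : map S (map predn w) = w.
    rewrite -map_comp map_id_in // => -[|x] //=.
    by rewrite (perm_mem pw) mem_iota.
  exists (map predn w) => //; rewrite mem_permutations.
  by apply: (perm_map_inj (f := S)) => [x y []|] //; rewrite wE -(iotaDl 1 1 n).
by rewrite mem_permutations => pv ->; rewrite (iotaDl 1 1 n); apply: perm_map.
Qed.

Lemma free_from_ge (x : nat) (w : seq nat) : all (fun y => x <= y) w -> free_from x w.
Proof.
move=> gew y z t /subseq_all/(_ gew) /=; rewrite /forbidden; lia.
Qed.

Lemma free_from_le (x : nat) (w : seq nat) : all (fun y => y <= x) w -> free_from x w.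
Proof.
move=> gew y z t /subseq_all/(_ gew) /=; rewrite /forbidden; lia.
Qed.

Lemma avoids_ge (x : nat) (w : seq nat) :
  all (fun y => x <= y) w -> avoids (x :: w) = avoids w.
Proof.
move=> gew; apply/idP/idP => [/avoids_cons[]//|av].
by apply/avoids_cons; split=> //; apply: free_from_ge.
Qed.

Lemma avoids_le (x : nat) (w : seq nat) :
  all (fun y => y <= x) w -> avoids (x :: w) = avoids w.
Proof.
move=> lew; apply/idP/idP => [/avoids_cons[]//|av].
by apply/avoids_cons; split=> //; apply: free_from_le.
Qed.

Lemma count_first_min (n : nat) :
  count (fun w => avoids (1 :: w)) (permutations (iota 2 n)) = num_avoiding n.
Proof.
rewrite (seq.permP (perm_iota2 n)) count_map; apply: eq_count => w /=.
rewrite avoids_ge ?avoids_map //.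
by apply/allP => _ /mapP[y _ ->].
Qed.

Lemma count_first_min_max_last (n : nat) :
  count (fun w => avoids (1 :: rcons w n.+2)) (permutations (iota 2 n)) =
  num_avoiding_max_last n.
Proof.
rewrite (seq.permP (perm_iota2 n)) count_map; apply: eq_count => w /=.
rewrite -map_rcons avoids_ge ?avoids_map //.
by apply/allP => _ /mapP[y _ ->].
Qed.

Lemma count_first_max (n : nat) :
  count (fun w => avoids (n.+1 :: w)) (permutations (iota 1 n)) = num_avoiding n.
Proof.
apply: eq_in_count => w; rewrite mem_permutations => pw.
rewrite avoids_le //; apply/allP => y; rewrite (perm_mem pw) mem_iota; lia.
Qed.

Lemma perm_low_high (m b : nat) (L H : seq nat) :
  all (fun y => y < m.+1) L -> all (fun y => m.+1 < y) H ->
  perm_eq (L ++ H) (iota 1 m ++ iota m.+2 b) ->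
  perm_eq L (iota 1 m) /\ perm_eq H (iota m.+2 b).
Proof.
move=> ltL gtH pLH.
pose lo := fun y => y < m.+1; pose hi := fun y => m.+1 < y.
have ltI : all lo (iota 1 m) by apply/allP => y; rewrite mem_iota /lo; lia.
have gtI : all hi (iota m.+2 b) by apply/allP => y; rewrite mem_iota /hi; lia.
have lo0 s : all hi s -> filter lo s = [::].
  move=> his; apply/eqP; rewrite -[_ == _]negbK -has_filter -all_predC.
  by apply: sub_all his => y; rewrite /lo /hi /=; lia.
have hi0 s : all lo s -> filter hi s = [::].
  move=> los; apply/eqP; rewrite -[_ == _]negbK -has_filter -all_predC.
  by apply: sub_all los => y; rewrite /lo /hi /=; lia.
have := perm_filter lo pLH; have := perm_filter hi pLH; rewrite !filter_cat.
rewrite (all_filterP ltL) (all_filterP gtH) (all_filterP ltI) (all_filterP gtI).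
by rewrite !lo0 // !hi0 // !cats0.
Qed.

Lemma sorted_perm_iota (H : seq nat) (k b : nat) :
  sorted ltn H -> perm_eq H (iota k b) -> H = iota k b.
Proof.
move=> sH /perm_mem mH; apply: (irr_sorted_eq ltn_trans ltnn) => //.
exact: iota_ltn_sorted.
Qed.

Lemma perm_iota_insert (m : nat) (S1 S2 : seq nat) :
  perm_eq (S1 ++ m.+1 :: S2) (iota 1 m.+1) = perm_eq (S1 ++ S2) (iota 1 m).
Proof.
have -> : iota 1 m.+1 = iota 1 m ++ [:: m.+1] by rewrite -[X in iota 1 X]addn1 iotaD.
by rewrite -cat1s perm_catCA perm_sym perm_catC perm_cat2l perm_sym.
Qed.

Lemma perm_iota_pivot (m : nat) (w : seq nat) :
  perm_eq w (iota 1 m.+1) ->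
  exists S1 S2, [/\ w = S1 ++ m.+1 :: S2, all (fun y => y < m.+1) S1,
     all (fun y => y < m.+1) S2 & perm_eq (S1 ++ S2) (iota 1 m)].
Proof.
move=> pw; have : m.+1 \in w by rewrite (perm_mem pw) mem_iota; lia.
move=> mw; case/splitPr: mw pw => S1 S2; rewrite perm_iota_insert => pw.
have : all (fun y => y < m.+1) (S1 ++ S2).
  by apply/allP => y; rewrite (perm_mem pw) mem_iota; lia.
by rewrite all_cat => /andP[? ?]; exists S1, S2.
Qed.

(** The [a] on the right is not the leading letter, which starts no occurrence and is dropped, but
    the value given to the shrunken block. *)
Lemma avoids_block (a : nat) (S1 B S2 : seq nat) :
  all (fun y => y < a) S1 -> all (fun y => a < y) B -> all (fun y => y < a) S2 ->
  sorted ltn B -> B != [::] ->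
  avoids (a :: S1 ++ B ++ S2) = avoids (S1 ++ a :: S2).
Proof.
move=> ltS1 gtB ltS2 sB nB; rewrite -(avoids_inflate ltS1 gtB ltS2 sB nB).
apply/idP/idP => [/avoids_cons[]//|av].
by apply/avoids_cons; split=> //; apply: free_from_block.
Qed.

(** The leading [a] starts no occurrence, [B1] is an increasing prefix above the rest, and [B2]
    shrinks to the final [a]. *)
Lemma avoids_two_blocks (a : nat) (B1 S B2 : seq nat) :
  all (fun y => a < y) B1 -> all (fun y => y < a) S -> all (fun y => a < y) B2 ->
  sorted ltn (B2 ++ B1) -> B2 != [::] ->
  avoids (a :: B1 ++ S ++ B2) = avoids (rcons S a).
Proof.
move=> gtB1 ltS gtB2 sB nB.
have [sB2 sB1 lt21] : [/\ sorted ltn B2, sorted ltn B1 & allrel ltn B2 B1].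
  move: sB; rewrite !(sorted_pairwise ltn_trans) pairwise_cat.
  by move/and3P=> [? ? ?]; split.
have -> : avoids (a :: B1 ++ S ++ B2) = avoids (B1 ++ S ++ B2).
  apply/idP/idP => [/avoids_cons[]//|av].
  by apply/avoids_cons; split=> //; apply: free_from_two_blocks.
rewrite avoids_top // => [|x y xB1].
  by have := @avoids_inflate a S B2 [::] ltS gtB2 isT sB2 nB; rewrite cats0 cats1.
have := allP gtB1 _ xB1; rewrite mem_cat => gtx /orP[yS|yB2].
  by apply: ltn_trans gtx; exact: (allP ltS).
exact: (allrelP lt21).
Qed.

(** * The two families of words with a middle first letter *)

Definition inflate (a b : nat) (w : seq nat) : seq nat :=
  flatten [seq if y == a then iota a.+1 b else [:: y] | y <- w].

(** Left inverse of [inflate] for nonempty blocks, on words with [a] as single maximum: of the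
    block, the filter keeps only [a.+1], which [minn] turns into [a]. It serves to prove
    injectivity. *)
Definition deflate (a : nat) (w : seq nat) : seq nat :=
  [seq minn y a | y <- w & y <= a.+1].

Lemma inflateE (a b : nat) (S1 S2 : seq nat) :
  all (fun y => y < a) S1 -> all (fun y => y < a) S2 ->
  inflate a b (S1 ++ a :: S2) = S1 ++ iota a.+1 b ++ S2.
Proof.
move=> ltS1 ltS2; rewrite /inflate map_cat flatten_cat /= eqxx.
have id_lt S : all (fun y => y < a) S ->
    flatten [seq if y == a then iota a.+1 b else [:: y] | y <- S] = S.
  elim: S => //= y S IH /andP[lty /IH ->].
  by case: eqP lty => // ->; rewrite ltnn.
by rewrite !id_lt.
Qed.

Lemma deflateE (a b : nat) (S1 S2 : seq nat) :
  all (fun y => y < a) S1 -> all (fun y => y < a) S2 ->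
  deflate a (S1 ++ iota a.+1 b.+1 ++ S2) = S1 ++ a :: S2.
Proof.
move=> ltS1 ltS2; rewrite /deflate !filter_cat !map_cat /=.
have id_lt S : all (fun y => y < a) S -> [seq minn y a | y <- S & y <= a.+1] = S.
  elim: S => //= y S IH /andP[lty /IH E].
  have -> : y <= a.+1 by lia.
  by rewrite /= E; congr (_ :: _); lia.
rewrite !id_lt // leqnn /=.
have -> : [seq y <- iota a.+2 b | y <= a.+1] = [::].
  apply/eqP; rewrite -[_ == _]negbK -has_filter -all_predC.
  by apply/allP => y; rewrite mem_iota /=; lia.
by congr (_ ++ _ :: _); lia.
Qed.

Lemma all_gt_iota (a j b : nat) : a < j -> all (fun y => a < y) (iota j b).
Proof. by move=> ltaj; apply/allP => y; rewrite mem_iota; lia. Qed.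

Lemma perm_iota_lt (m : nat) (w : seq nat) :
  perm_eq w (iota 1 m) -> all (fun y => y < m.+1) w.
Proof. by move=> pw; apply/allP => y; rewrite (perm_mem pw) mem_iota; lia. Qed.

(** [j] is the length of the final, lower block. It runs from 1 to [b.-1], so that both blocks are
    nonempty. *)
Definition two_blocks (m b : nat) : seq (seq nat) :=
  [seq iota (m.+2 + j) (b - j) ++ w ++ iota m.+2 j | j <- iota 1 b.-1,
     w <- [seq w <- permutations (iota 1 m) | avoids (rcons w m.+1)]].

Lemma two_blocksP (m b : nat) (w : seq nat) :
  reflect (exists j S, [/\ 0 < j < b, perm_eq S (iota 1 m), avoids (rcons S m.+1) &
             w = iota (m.+2 + j) (b - j) ++ S ++ iota m.+2 j])
          (w \in two_blocks m b).
Proof.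
apply: (iffP allpairsP) => [[[j S] /= [jI]]|[j [S [jI pS av ->]]]].
  rewrite mem_filter mem_permutations => /andP[av pS] ->; exists j, S; split=> //.
  by move: jI; rewrite mem_iota; lia.
exists (j, S); split=> //=; first by rewrite mem_iota; lia.
by rewrite mem_filter av mem_permutations.
Qed.

(** The first letter [m.+2 + j] reveals [j], and then the lengths isolate the middle word. *)
Lemma two_blocks_uniq (m b : nat) : uniq (two_blocks m b).
Proof.
apply: allpairs_uniq; rewrite ?filter_uniq ?permutations_uniq ?iota_uniq //.
move=> [j S] [j' S'] /allpairsP[[j1 S1] /= [jI _ [jE _]]].
case/allpairsP=> [[j2 S2] /= [j'I _ [j'E _]]].
move: jI j'I; rewrite -{}jE -{}j'E => jI j'I.
have jb i : i \in iota 1 b.-1 -> exists k, b - i = k.+1.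
  by rewrite mem_iota => ?; exists (b - i).-1; lia.
have [k kE] := jb _ jI; have [k' k'E] := jb _ j'I.
move=> E; have jj' : j = j' by move: E; rewrite kE k'E => -[]; lia.
subst j'; move: E => /eqP; rewrite eqseq_cat // => /andP[_ /eqP E].
have szS : size S = size S' by have /eqP := congr1 size E; rewrite !size_cat eqn_add2r => /eqP.
by move/eqP: E; rewrite eqseq_cat // => /andP[/eqP->].
Qed.

(** The increasing word [B2 ++ B1] is the whole interval of large letters, so the length of [B2]
    determines both blocks. *)
Lemma perm_eq_two_blocks (m b : nat) (B1 S B2 : seq nat) :
  all (fun y => m.+1 < y) B1 -> all (fun y => y < m.+1) S ->
  all (fun y => m.+1 < y) B2 -> sorted ltn (B2 ++ B1) ->
  perm_eq (B1 ++ S ++ B2) (iota 1 m ++ iota m.+2 b) ->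
  [/\ perm_eq S (iota 1 m), b = size B2 + size B1, B2 = iota m.+2 (size B2) &
     B1 = iota (m.+2 + size B2) (size B1)].
Proof.
move=> gtB1 ltS gtB2 sB p.
have p' : perm_eq (S ++ (B2 ++ B1)) (iota 1 m ++ iota m.+2 b).
  by rewrite catA perm_catC.
have gtB : all (fun y => m.+1 < y) (B2 ++ B1) by rewrite all_cat gtB2.
have [pS /(sorted_perm_iota sB) E] := perm_low_high ltS gtB p'.
have bE : b = size B2 + size B1 by rewrite -size_cat E size_iota.
move: E; rewrite bE iotaD => /eqP; rewrite eqseq_cat ?size_iota // => /andP[/eqP ? /eqP ?].
by split.
Qed.

(** The words counted are the inflations of the avoiders of length [m.+1], one for each, and the
    two-block words, whose lower block has any of the lengths from 1 to [b]. *)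
Lemma count_first_middle (m b : nat) :
  0 < m ->
  count (fun w => avoids (m.+1 :: w)) (permutations (iota 1 m ++ iota m.+2 b.+1)) =
  num_avoiding m.+1 + b * num_avoiding_max_last m.
Proof.
move=> m_gt0; set a := m.+1.
have uI : uniq (iota 1 m ++ iota a.+1 b.+1).
  rewrite cat_uniq !iota_uniq andTb andbT; apply/hasPn => y.
  by rewrite !mem_iota; lia.
pose E := [seq w <- permutations (iota 1 a) | avoids w].
have gtI j k : a < j -> all (fun y => a < y) (iota j k) by exact: all_gt_iota.
have EP w : w \in E -> exists S1 S2, [/\ w = S1 ++ a :: S2, all (fun y => y < a) S1,
     all (fun y => y < a) S2, perm_eq (S1 ++ S2) (iota 1 m) & avoids w].
  rewrite mem_filter mem_permutations => /andP[av /perm_iota_pivot].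
  by move=> [S1 [S2 [? ? ? ?]]]; exists S1, S2.
rewrite -size_filter.
transitivity (size (map (inflate a b.+1) E ++ two_blocks m b.+1)); last first.
  by rewrite size_cat size_map size_allpairs size_iota !size_filter.
apply/perm_size/uniq_perm.
- by rewrite filter_uniq ?permutations_uniq.
- rewrite cat_uniq two_blocks_uniq andbT; apply/andP; split.
    rewrite map_inj_in_uniq ?filter_uniq ?permutations_uniq // => u v.
    move=> /EP[S1 [S2 [-> ltS1 ltS2 _ _]]] /EP[S3 [S4 [-> ltS3 ltS4 _ _]]].
    by rewrite !inflateE // => /(congr1 (deflate a)); rewrite !deflateE.
  (* The families are disjoint: an inflated word starts with a small letter or with [a.+1], a
     two-block word with [m.+2 + j] where [j > 0]. *)
  apply/hasPn => w /two_blocksP[j [S [jb _ _ ->]]].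
  apply/mapP => -[v /EP[S1 [S2 [-> ltS1 ltS2 _ _]]]]; rewrite inflateE //.
  have -> : b.+1 - j = (b - j).+1 by lia.
  case: S1 ltS1 => [_|x S1] /= => [[]|/andP[ltx _] []]; lia.
move=> w; rewrite mem_filter mem_permutations mem_cat; apply/idP/idP.
  case/andP=> av pw; have /avoids_cons[okw _] := av.
  have uw : uniq w by rewrite (perm_uniq pw).
  have aw : a \notin w by rewrite (perm_mem pw) mem_cat !mem_iota; lia.
  have hw : has (fun y => y < a) w.
    by apply/hasP; exists 1 => //; rewrite (perm_mem pw) mem_cat !mem_iota; lia.
  have [[S1 [B [S2 [wE ltS1 gtB ltS2 sB]]]]|] := free_from_shape uw aw hw okw.
    have [pS BE] : perm_eq (S1 ++ S2) (iota 1 m) /\ B = iota a.+1 b.+1.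
      have ltS : all (fun y => y < a) (S1 ++ S2) by rewrite all_cat ltS1.
      have p' : perm_eq ((S1 ++ S2) ++ B) (iota 1 m ++ iota m.+2 b.+1).
        apply: perm_trans pw; rewrite wE -catA perm_cat2l perm_catC; exact: perm_refl.
      by have [pS /(sorted_perm_iota sB)] := perm_low_high ltS gtB p'.
    apply/orP; left; apply/mapP; exists (S1 ++ a :: S2); last first.
      by rewrite inflateE // wE BE.
    rewrite mem_filter mem_permutations; apply/andP; split.
      by rewrite -(avoids_block ltS1 gtB ltS2 sB) -?wE // BE.
    by rewrite perm_iota_insert.
  move=> [B1 [S [B2 [wE gtB1 ltS gtB2 [nB1 nB2 sB]]]]].
  rewrite wE in pw; have [pS bE B2E B1E] := perm_eq_two_blocks gtB1 ltS gtB2 sB pw.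
  apply/orP; right; apply/two_blocksP; exists (size B2), S; split=> //.
  - move: nB1 nB2; rewrite -!size_eq0 -!lt0n bE => pos1 pos2.
    by rewrite pos2 -[X in X < _]addn0 ltn_add2l.
  - by rewrite -(avoids_two_blocks gtB1 ltS gtB2 sB nB2) -wE.
  - by rewrite bE addKn -B2E -B1E.
case/orP=> [/mapP[v /EP[S1 [S2 [-> ltS1 ltS2 pS av]]] ->]|].
  rewrite inflateE // avoids_block ?gtI ?iota_ltn_sorted // av andTb.
  by rewrite perm_catCA perm_sym perm_catC perm_cat2l perm_sym.
case/two_blocksP=> j [S [jb pS av ->]].
have jbE : j + (b.+1 - j) = b.+1 by lia.
rewrite avoids_two_blocks ?gtI ?(perm_iota_lt pS) //; try lia.
- by rewrite av andTb perm_catC -catA -iotaD jbE perm_cat2r.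
- by rewrite -iotaD iota_ltn_sorted.
by rewrite -size_eq0 size_iota; lia.
Qed.

(** The final maximum excludes the two-block shape, where the maximum ends the first block, and also
    any small letters after a single block. So [w] is a word on the small letters followed by an
    increasing block. *)
Lemma count_first_middle_max_last (m b : nat) :
  0 < m ->
  count (fun w => avoids (m.+1 :: rcons w (m.+2 + b)))
        (permutations (iota 1 m ++ iota m.+2 b)) = num_avoiding_max_last m.
Proof.
move=> m_gt0; set a := m.+1.
have uI : uniq (iota 1 m ++ iota a.+1 b).
  rewrite cat_uniq !iota_uniq andTb andbT; apply/hasPn => y.
  by rewrite !mem_iota; lia.
have topE : rcons (iota a.+1 b) (a.+1 + b) = iota a.+1 b.+1.
  by rewrite -[b.+1]addn1 iotaD cats1.
have gtI j k : a < j -> all (fun y => a < y) (iota j k) by exact: all_gt_iota.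
pose G := [seq w <- permutations (iota 1 m) | avoids (rcons w a)].
rewrite -size_filter /num_avoiding_max_last -size_filter -/G.
transitivity (size (map (fun w => w ++ iota a.+1 b) G)); last by rewrite size_map.
apply/perm_size/uniq_perm.
- by rewrite filter_uniq ?permutations_uniq.
- rewrite map_inj_in_uniq ?filter_uniq ?permutations_uniq // => u v _ _ E.
  have szuv : size u = size v.
    by have /eqP := congr1 size E; rewrite !size_cat eqn_add2r => /eqP.
  by move/eqP: E; rewrite eqseq_cat // => /andP[/eqP->].
have av1 S : perm_eq S (iota 1 m) ->
    avoids (a :: rcons (S ++ iota a.+1 b) (a.+1 + b)) = avoids (rcons S a).
  move=> /perm_iota_lt ltS; rewrite rcons_cat topE.
  have := @avoids_block a S (iota a.+1 b.+1) [::] ltS (gtI _ _ _) isT.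
  by rewrite cats0 cats1 => -> //; exact: iota_ltn_sorted.
move=> w; rewrite mem_filter mem_permutations; apply/idP/mapP; last first.
  move=> [S]; rewrite mem_filter mem_permutations => /andP[av pS] ->.
  by rewrite av1 // av perm_cat2r.
case/andP=> av pw; have /avoids_cons[okw _] := av.
suff [S [wE pS]] : exists S, w = S ++ iota a.+1 b /\ perm_eq S (iota 1 m).
  by exists S => //; rewrite mem_filter mem_permutations pS -av1 // -wE av.
set v := rcons w _ in av okw.
have pv : perm_eq v (iota 1 m ++ iota a.+1 b.+1).
  by rewrite -topE -rcons_cat perm_rcons perm_sym perm_rcons perm_cons perm_sym.
have uv : uniq v.
  rewrite (perm_uniq pv) cat_uniq !iota_uniq andTb andbT; apply/hasPn => y.
  by rewrite !mem_iota; lia.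
have aNv : a \notin v by rewrite (perm_mem pv) mem_cat !mem_iota; lia.
have hv : has (fun y => y < a) v.
  by apply/hasP; exists 1 => //; rewrite (perm_mem pv) mem_cat !mem_iota; lia.
have lastv : last 0 v = a.+1 + b by rewrite last_rcons.
have [[S1 [B [S2 [vE ltS1 gtB ltS2 sB]]]]|] := free_from_shape uv aNv hv okw.
  case: (lastP S2) => [|S2' y] in vE ltS2 *; last first.
    move: lastv ltS2; rewrite vE !last_cat last_rcons all_rcons => -> /andP[]; lia.
  rewrite cats0 in vE; rewrite vE in pv.
  have [pS /(sorted_perm_iota sB) BE] := perm_low_high ltS1 gtB pv.
  exists S1; split=> //.
  by move: vE; rewrite /v BE -topE -rcons_cat => /rcons_inj[].
move=> [B1 [S [B2 [vE gtB1 ltS gtB2 [nB1 nB2 sB]]]]].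
rewrite vE in pv; have [_ bE B2E _] := perm_eq_two_blocks gtB1 ltS gtB2 sB pv.
(* Ending the word, [B2] would contain the maximum, which leaves no larger letter for [B1]. *)
have lB2 : last 0 B2 = a.+1 + b.
  by rewrite -lastv vE !last_cat; case: (B2) nB2.
have : a.+1 + b \in B2 by rewrite -lB2; case: (B2) nB2 => //= *; exact: mem_last.
rewrite B2E mem_iota => /andP[_]; rewrite ltn_add2l bE.
rewrite -[X in _ <= X]addn0 leq_add2l leqn0 => /eqP/size0nil B1E.
by rewrite B1E in nB1.
Qed.

(** * Recurrences and the generating function *)

Lemma one_line_inj (n : nat) : injective (@one_line n).
Proof.
move=> s s' /eq_in_map eq_ss'; apply/permP => i.
by apply/val_inj/succn_inj/eq_ss'; rewrite mem_enum.
Qed.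

Lemma perm_one_line (n : nat) (s : 'S_n) : perm_eq (one_line s) (iota 1 n).
Proof.
rewrite (iotaDl 1 0) -val_enum_ord -map_comp.
have -> : one_line s = [seq (val i).+1 | i <- map s (enum 'I_n)].
  by rewrite -map_comp.
have uI : uniq (enum 'I_n) by exact: fintype.enum_uniq.
apply/perm_map/uniq_perm => //; first by rewrite (map_inj_uniq (@perm_inj _ s)).
move=> i; rewrite [RHS]mem_enum; apply/mapP.
by exists (s^-1%g i); rewrite ?mem_enum ?permKV.
Qed.

Lemma card_avoiders (n : nat) :
  #|avoiders n [:: [:: 2; 1; 4; 3]; [:: 2; 3; 1; 4]; [:: 2; 4; 3; 1]]| =
  num_avoiding n.
Proof.
have/seq.permP peq : perm_eq [seq one_line s | s <- enum {perm 'I_n}] (permutations (iota 1 n)).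
  have us : uniq [seq one_line s | s <- enum {perm 'I_n}].
    by rewrite (map_inj_uniq (@one_line_inj n)); exact: fintype.enum_uniq.
  apply: uniq_perm => //; first exact: permutations_uniq.
  have sub : {subset [seq one_line s | s <- enum {perm 'I_n}] <= permutations (iota 1 n)}.
    by move=> _ /mapP[s _ ->]; rewrite mem_permutations perm_one_line.
  apply: (uniq_min_size us sub _).2.
  rewrite size_permutations ?iota_uniq // size_iota size_map -cardE.
  by rewrite card_Sn.
rewrite /num_avoiding -peq count_map -sum1_card -sum1_count big_enum_cond.
by apply: eq_bigl => s; rewrite inE.
Qed.

(** The first letters 1 and [n.+2] contribute [num_avoiding n.+1] each; the index [i] stands for the
    first letter [i.+2]. *)
Lemma num_avoiding_rec (n : nat) :
  num_avoiding n.+2 = num_avoiding n.+1 + num_avoiding n.+1 +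
    \sum_(i < n) (num_avoiding i.+2 + (n - i.+1) * num_avoiding_max_last i.+1).
Proof.
rewrite {1}/num_avoiding count_permutations_first big_nat_recl // big_nat_recr //.
rewrite subn0 subnn cats0 count_first_min count_first_max big_mkord.
rewrite [X in _ + X]addnC addnA; congr (_ + _); apply: eq_bigr => i _.
have -> : n.+1 - i.+1 = (n - i.+1).+1 by case: i => /=; lia.
exact: count_first_middle.
Qed.

Lemma num_avoiding_max_last_rec (n : nat) :
  num_avoiding_max_last n.+1 = num_avoiding_max_last n +
    \sum_(i < n) num_avoiding_max_last i.+1.
Proof.
rewrite {1}/num_avoiding_max_last count_permutations_first big_nat_recl // subn0.
rewrite count_first_min_max_last big_mkord; congr (_ + _); apply: eq_bigr => i _.
rewrite -(count_first_middle_max_last (n - i.+1)) //; apply: eq_count => w.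
by rewrite rcons_cons; congr (avoids (_ :: rcons _ _)); case: i => /=; lia.
Qed.

Lemma avoids_nil : avoids [::].
Proof. exact/avoidsP. Qed.

Lemma num_avoiding0 : num_avoiding 0 = 1.
Proof. by rewrite /num_avoiding /= avoids_nil. Qed.

Lemma num_avoiding1 : num_avoiding 1 = 1.
Proof.
rewrite /num_avoiding count_permutations_first big_nat1.
by rewrite count_first_min num_avoiding0.
Qed.

Lemma num_avoiding_max_last0 : num_avoiding_max_last 0 = 1.
Proof. by rewrite /num_avoiding_max_last /= avoids_ge ?avoids_nil. Qed.

(** Subtracting consecutive instances of the previous recurrence leaves one term of the sum. This is
    the factor $1-3x+x^2$. *)
Lemma num_avoiding_max_last_rec2 (n : nat) :
  num_avoiding_max_last n.+2 + num_avoiding_max_last n = 3 * num_avoiding_max_last n.+1.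
Proof.
have := num_avoiding_max_last_rec n.+1; have := num_avoiding_max_last_rec n.
by rewrite big_ord_recr /=; lia.
Qed.

(** Again a difference of consecutive instances; the remaining sum of [num_avoiding_max_last] is
    evaluated by its own recurrence. The terms in [num_avoiding] carry the factor $1-4x+2x^2$. *)
Lemma num_avoiding_rec3 (n : nat) :
  num_avoiding n.+3 + 2 * num_avoiding n.+1 + num_avoiding_max_last n =
  4 * num_avoiding n.+2 + num_avoiding_max_last n.+1.
Proof.
have := num_avoiding_rec n.+1; have := num_avoiding_rec n.
have := num_avoiding_max_last_rec n.
(* The new term [i = n] has weight zero, and every other weight grows by one. *)
rewrite big_ord_recr /= subnn mul0n addn0.
have -> : \sum_(i < n) (num_avoiding i.+2 + (n.+1 - i.+1) * num_avoiding_max_last i.+1) =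
  \sum_(i < n) (num_avoiding i.+2 + (n - i.+1) * num_avoiding_max_last i.+1) +
  \sum_(i < n) num_avoiding_max_last i.+1.
  rewrite -big_split; apply: eq_bigr => i _ /=.
  have -> : n.+1 - i.+1 = (n - i.+1).+1 by case: i => /=; lia.
  by rewrite mulSn; lia.
set h := \sum_(i < n) num_avoiding_max_last i.+1; set s := \sum_(i < n) _.
lia.
Qed.

(** Combining three instances of [num_avoiding_rec3] with coefficients 1, -3, 1 cancels
    [num_avoiding_max_last]. The relation fails one index earlier, at [num_avoiding 0], in
    accordance with the $x^4$ in the numerator. *)
Lemma num_avoiding_linear_rec (n : nat) :
  num_avoiding n.+4.+1 + 15 * num_avoiding n.+3 + 2 * num_avoiding n.+1 =
  7 * num_avoiding n.+4 + 10 * num_avoiding n.+2.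
Proof.
have := num_avoiding_rec3 n; have := num_avoiding_rec3 n.+1.
have := num_avoiding_rec3 n.+2.
have := num_avoiding_max_last_rec2 n; have := num_avoiding_max_last_rec2 n.+1.
lia.
Qed.

Lemma num_avoiding_small :
  [/\ num_avoiding 2 = 2, num_avoiding 3 = 6 & num_avoiding 4 = 21].
Proof.
have := num_avoiding_rec 0; have := num_avoiding_max_last_rec 0.
have := num_avoiding_max_last_rec2 0.
have := num_avoiding_rec3 0; have := num_avoiding_rec3 1.
rewrite !big_ord0 num_avoiding1 num_avoiding_max_last0.
by move=> *; split; lia.
Qed.

(** * Comparison with the rational function *)

Local Open Scope ring_scope.

Lemma numeratorE :
  1 - 6%:R *: 'X + 10%:R *: 'X^2 - 3%:R *: 'X^3 + 'X^4 =
  Poly [:: 1; - 6%:R; 10%:R; - 3%:R; 1] :> {poly rat}.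
Proof.
rewrite /= !cons_poly_def -!mul_polyC !rmorphN !rmorph_nat !rmorph1; ring.
Qed.

Lemma denominatorE :
  (1 - 3%:R *: 'X + 'X^2) * (1 - 4%:R *: 'X + 2%:R *: 'X^2) =
  Poly [:: 1; - 7%:R; 15%:R; - 10%:R; 2%:R] :> {poly rat}.
Proof.
rewrite /= !cons_poly_def -!mul_polyC !rmorphN !rmorph_nat !rmorph1; ring.
Qed.

Lemma fps_of_PolyE (s : seq rat) (n : nat) : fps_of_poly (Poly s) n = s`_n.
Proof. exact: coef_Poly. Qed.

Theorem theorem21 :
  avoidance_gf
    [:: [:: 2; 1; 4; 3]%N; [:: 2; 3; 1; 4]%N; [:: 2; 4; 3; 1]%N] =1
  fps_div
    (fps_of_poly (1 - 6%:R *: 'X + 10%:R *: 'X^2 - 3%:R *: 'X^3 + 'X^4))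
    (fps_of_poly ((1 - 3%:R *: 'X + 'X^2) * (1 - 4%:R *: 'X + 2%:R *: 'X^2))).
Proof.
rewrite numeratorE denominatorE /fps_div /avoidance_gf => n.
rewrite card_avoiders /fps_mul; set q := fps_of_poly (Poly (_ :: - 7%:R :: _)).
set e := fps_inv q.
have qE i : q i = [:: 1; - 7%:R; 15%:R; - 10%:R; 2%:R]`_i by exact: fps_of_PolyE.
have eS k : e k.+1 = - \sum_(i < k.+1) q i.+1 * e (k - i)%N.
  by rewrite /e fps_inv_rec qE invr1 mulN1r.
have e0 : e 0 = 1 by rewrite /e /fps_inv /= qE invr1.
have e1 : e 1 = 7%:R.
  by rewrite eS !big_ord_recl big_ord0 !qE /= e0; ring.
have e2 : e 2 = 34%:R.
  by rewrite eS !big_ord_recl big_ord0 !qE /= e0 e1; ring.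
have e3 : e 3 = 143%:R.
  by rewrite eS !big_ord_recl big_ord0 !qE /= e0 e1 e2; ring.
(* The denominator has degree 4, so the terms of the sum after the fourth vanish. *)
have e4 k : e k.+4 = 7%:R * e k.+3 - 15%:R * e k.+2 + 10%:R * e k.+1 - 2%:R * e k.
  rewrite eS !big_ord_recl big1 => [|i _]; last by rewrite qE /= nth_nil mul0r.
  by rewrite !qE /= /bump /= !add1n !subSS !subn0; ring.
pose a k := \sum_(i < k.+1)
  fps_of_poly (Poly [:: 1; - 6%:R; 10%:R; - 3%:R; 1]) i * e (k - i)%N.
rewrite -/(a n).
have a4 k : a k.+4 = e k.+4 - 6%:R * e k.+3 + 10%:R * e k.+2 - 3%:R * e k.+1 + e k.
  rewrite /a !big_ord_recl big1 => [|i _]; last by rewrite fps_of_PolyE /= nth_nil mul0r.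
  by rewrite !fps_of_PolyE /= /bump /= !add1n !subSS !subn0; ring.
have a0 : a 0 = 1 by rewrite /a big_ord1 fps_of_PolyE /= e0; ring.
have a1 : a 1 = 1.
  by rewrite /a !big_ord_recl big_ord0 !fps_of_PolyE /= e0 e1; ring.
have a2 : a 2 = 2%:R.
  by rewrite /a !big_ord_recl big_ord0 !fps_of_PolyE /= e0 e1 e2; ring.
have a3 : a 3 = 6%:R.
  by rewrite /a !big_ord_recl big_ord0 !fps_of_PolyE /= e0 e1 e2 e3; ring.
have a4' : a 4 = 21%:R by rewrite a4 e4 e0 e1 e2 e3; ring.
have aS k : a k.+4.+1 = 7%:R * a k.+4 - 15%:R * a k.+3 + 10%:R * a k.+2 - 2%:R * a k.+1.
  (* [a4] covers only indices from 4 on, so the cases [k < 3] use the computed values of [a]. *)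
  case: k => [|[|[|k]]].
  - by rewrite !a4 ?a3 ?a2 ?a1 !e4 e3 e2 e1 e0; ring.
  - by rewrite !a4 ?a3 ?a2 ?a1 !e4 e3 e2 e1 e0; ring.
  - by rewrite !a4 ?a3 ?a2 ?a1 !e4 e3 e2 e1 e0; ring.
  - by rewrite !a4 !e4; ring.
have [f2 f3 f4] := num_avoiding_small.
(* Five initial values are needed: the recurrence has order 4 but starts at index 1. *)
elim/ltn_ind: n => -[|[|[|[|[|n]]]]] IH.
- by rewrite num_avoiding0 a0.
- by rewrite num_avoiding1 a1.
- by rewrite f2 a2.
- by rewrite f3 a3.
- by rewrite f4 a4'.
have E : (num_avoiding n.+4.+1)%:R + 15%:R * (num_avoiding n.+3)%:R +
    2%:R * (num_avoiding n.+1)%:R =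
    7%:R * (num_avoiding n.+4)%:R + 10%:R * (num_avoiding n.+2)%:R :> rat.
  by rewrite -!natrM -!natrD num_avoiding_linear_rec.
have IHk k : (k < 4)%N -> (num_avoiding (n + k.+1))%:R = a (n + k.+1)%N.
  by move=> ltk4; apply: IH; lia.
have := (IHk 0 isT, IHk 1 isT, IHk 2 isT, IHk 3 isT).
rewrite !addnS addn0 => -[[[h1 h2] h3] h4]; rewrite aS -h1 -h2 -h3 -h4.
(* [E] is free of subtraction, so the negative terms of [aS] are moved to the other side. *)
apply: (addIr (15%:R * (num_avoiding n.+3)%:R + 2%:R * (num_avoiding n.+1)%:R)).
by rewrite addrA E; ring.
Qed.
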